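(* Let $\mathbf{A}$ and $\mathbf{B}$ be categories and let $\eta:\mathrm{Mor}(\mathbf{A})\times\mathrm{Mor}(\mathbf{B})\to\mathrm{Mor}(\mathbf{A})$ be a map satisfying: (1) for any $k\in\mathrm{Hom}(a_1,a_2)$ and $f\in\mathrm{Hom}(b_1,b_2)$, where $a_1,a_2\in\mathrm{Obj}(\mathbf{A})$ and $b_1,b_2\in\mathrm{Obj}(\mathbf{B})$, one has $\eta(k,f)\in\mathrm{Hom}(a_1,a_2)$; (2) for any $k\in\mathrm{Mor}(\mathbf{A})$ and composable $f_2,f_1\in\mathrm{Mor}(\mathbf{B})$, $\eta(k,f_2\circ f_1)=\eta(\eta(k,f_2),f_1)$, and $\eta(k,1_b)=k$ for every $b\in\mathrm{Obj}(\mathbf{B})$; (3) for any $f\in\mathrm{Mor}(\mathbf{B})$ and composable $k_2,k_1\in\mathrm{Mor}(\mathbf{A})$, $\eta(k_2\circ k_1,f)=\eta(k_2,f)\circ\eta(k_1,f)$, and $\eta(1_a,f)=1_a$ for every $a\in\mathrm{Obj}(\mathbf{A})$. Then $\eta$ specifies a category $\mathbf{A}\rtimes_\eta\mathbf{B}$ with $$\mathrm{Obj}(\mathbf{A}\rtimes_\eta\mathbf{B})=\mathrm{Obj}(\mathbf{A})\times\mathrm{Obj}(\mathbf{B}),\qquad \mathrm{Mor}(\mathbf{A}\rtimes_\eta\mathbf{B})=\mathrm{Mor}(\mathbf{A})\times\mathrm{Mor}(\mathbf{B}),$$ the obvious (componentwise) source and target maps, and composition law $$(k_2,f_2)\circ_\eta(k_1,f_1)=\bigl(\eta(k_2,f_1)\circ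 k_1,\;f_2\circ f_1\bigr).$$
   Context: $1_x$ denotes the identity morphism at an object $x$. Morphisms $f_2,f_1$ are composable when the source of $f_2$ equals the target of $f_1$, and then the composite is $f_2\circ f_1$. *)

(* Defs.v *)
(* Categories are presented with a single type of morphisms, with source and
   target maps.  Composition is a partial operation: [comp C g f h] is g o f,
   where [h] proves that g and f are composable.  Assuming proof irrelevance,
   it does not depend on [h]. *)

Record category_on (Obj Mor : Type) : Type := CategoryOn {
  src : Mor -> Obj;
  tgt : Mor -> Obj;
  ident : Obj -> Mor;
  comp : forall g f : Mor, src g = tgt f -> Mor;
  src_ident : forall x, src (ident x) = x;
  tgt_ident : forall x, tgt (ident x) = x;
  src_comp : forall g f h, src (comp g f h) = src f;
  tgt_comp : forall g f h, tgt (comp g f h) = tgt g;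
  comp_ident_l : forall f (h : src (ident (tgt f)) = tgt f),
    comp (ident (tgt f)) f h = f;
  comp_ident_r : forall f (h : src f = tgt (ident (src f))),
    comp f (ident (src f)) h = f;
  (* By [src_comp] and [tgt_comp], the last two proofs always exist. *)
  comp_assoc : forall f3 f2 f1 (h32 : src f3 = tgt f2) (h21 : src f2 = tgt f1)
      (hl : src (comp f3 f2 h32) = tgt f1) (hr : src f3 = tgt (comp f2 f1 h21)),
    comp (comp f3 f2 h32) f1 hl = comp f3 (comp f2 f1 h21) hr
}.

Arguments src {Obj Mor} c _.
Arguments tgt {Obj Mor} c _.
Arguments ident {Obj Mor} c _.
Arguments comp {Obj Mor} c g f _.

Record category : Type := Category {
  Obj : Type;
  Mor : Type;
  structure :> category_on Obj Mor
}.

Definition is_hom {O M : Type} (C : category_on O M) (x y : O) (f : M) : Prop :=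
  src C f = x /\ tgt C f = y.

Definition composable {O M : Type} (C : category_on O M) (g f : M) : Prop :=
  src C g = tgt C f.

(* Main.v *)
Require Import Defs.

(** Condition (1) makes [eta (_, f)] preserve sources and targets.  Hence the
    componentwise source and target maps are compatible with the twisted
    composition, and two componentwise composable pairs do have a composite.
    By (3), [eta (_, f)] is an endofunctor of A that is the identity on
    objects; by (2), B acts through these endofunctors contravariantly.  The
    unit laws of the product use the unit clauses of (3) (on the left) and
    of (2) (on the right).  Associativity is, in the first component,

      eta (eta (k3, f2) o k2, f1) o k1
        = (eta (eta (k3, f2), f1) o eta (k2, f1)) o k1       by (3)
        = eta (k3, f2 o f1) o (eta (k2, f1) o k1)            by (2).

    Each of these steps rewrites under a composition whose arguments include
    a proof of composability.  The rewriting is possible because the category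
    axioms, which are stated for all such proofs, already force composites to
    be independent of them ([comp_irrelevance]). *)

(** The identity is a variable because it often sits at an object that equals
    [src C f] only propositionally, as when [f] is a composite. *)
Lemma comp_unit_r {O M : Type} (C : category_on O M) (f i : M)
    (h : src C f = tgt C i) :
  i = ident C (src C f) -> comp C f i h = f.
Proof. intros ->; apply comp_ident_r. Qed.

Lemma comp_unit_l {O M : Type} (C : category_on O M) (i f : M)
    (h : src C i = tgt C f) :
  i = ident C (tgt C f) -> comp C i f h = f.
Proof. intros ->; apply comp_ident_l. Qed.

(** Associativity for g, f and an identity equates a composite of g and f
    formed with [h] to one formed with an unrelated proof; the identity is
    then absorbed on both sides. *)
Lemma comp_irrelevance {O M : Type} (C : category_on O M) (g f : M)
    (h h' : src C g = tgt C f) :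
  comp C g f h = comp C g f h'.
Proof.
  pose (i := ident C (src C f)).
  assert (hfi : src C f = tgt C i) by (symmetry; apply tgt_ident).
  assert (hl : src C (comp C g f h) = tgt C i)
    by (rewrite src_comp; exact hfi).
  assert (absorb : comp C f i hfi = f) by (apply comp_unit_r; reflexivity).
  assert (assoc : forall hr, comp C g f h = comp C g (comp C f i hfi) hr).
  { intros hr; rewrite <- (comp_assoc _ _ C g f i h hfi hl hr).
    symmetry; apply comp_unit_r; unfold i; now rewrite src_comp. }
  (* [assoc] quantifies over [hr], so [f] can replace [comp C f i hfi] in it. *)
  rewrite absorb in assoc; apply assoc.
Qed.

Lemma comp_congr {O M : Type} (C : category_on O M) (g g' f f' : M)
    (h : src C g = tgt C f) (h' : src C g' = tgt C f') :
  g = g' -> f = f' -> comp C g f h = comp C g' f' h'.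
Proof. intros -> ->; apply comp_irrelevance. Qed.

Theorem proposition5p1 :
  forall (A B : category) (eta : Mor A * Mor B -> Mor A),
    (* (1) *)
    (forall (a1 a2 : Obj A) (b1 b2 : Obj B) (k : Mor A) (f : Mor B),
        is_hom A a1 a2 k -> is_hom B b1 b2 f -> is_hom A a1 a2 (eta (k, f))) ->
    (* (2) *)
    (forall (k : Mor A) (f2 f1 : Mor B) (h : composable B f2 f1),
        eta (k, comp B f2 f1 h) = eta (eta (k, f2), f1)) ->
    (forall (k : Mor A) (b : Obj B), eta (k, ident B b) = k) ->
    (* (3) *)
    (forall (f : Mor B) (k2 k1 : Mor A) (h : composable A k2 k1),
        exists h' : composable A (eta (k2, f)) (eta (k1, f)),
          eta (comp A k2 k1 h, f) = comp A (eta (k2, f)) (eta (k1, f)) h') ->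
    (forall (a : Obj A) (f : Mor B), eta (ident A a, f) = ident A a) ->
    exists C : category_on (Obj A * Obj B) (Mor A * Mor B),
      (forall (k : Mor A) (f : Mor B), src C (k, f) = (src A k, src B f)) /\
      (forall (k : Mor A) (f : Mor B), tgt C (k, f) = (tgt A k, tgt B f)) /\
      (forall (k2 k1 : Mor A) (f2 f1 : Mor B)
              (h : composable C (k2, f2) (k1, f1)),
          exists (hA : composable A (eta (k2, f1)) k1)
                 (hB : composable B f2 f1),
            comp C (k2, f2) (k1, f1) h
              = (comp A (eta (k2, f1)) k1 hA, comp B f2 f1 hB)).
Proof.
  intros A B eta eta_hom eta_comp_r eta_id_r eta_comp_l eta_id_l.
  assert (eta_src : forall k f, src A (eta (k, f)) = src A k)
    by (intros k f; now apply (eta_hom _ (tgt A k) (src B f) (tgt B f))).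
  assert (eta_tgt : forall k f, tgt A (eta (k, f)) = tgt A k)
    by (intros k f; now apply (eta_hom (src A k) _ (src B f) (tgt B f))).
  pose (s := fun p : Mor A * Mor B => (src A (fst p), src B (snd p))).
  pose (t := fun p : Mor A * Mor B => (tgt A (fst p), tgt B (snd p))).
  pose (compA := fun (q p : Mor A * Mor B) (h : s q = t p) =>
    eq_trans (eta_src (fst q) (snd p)) (f_equal fst h)
      : src A (eta (fst q, snd p)) = tgt A (fst p)).
  pose (compB := fun (q p : Mor A * Mor B) (h : s q = t p) =>
    f_equal snd h : src B (snd q) = tgt B (snd p)).
  unshelve eexists
    (CategoryOn (Obj A * Obj B) (Mor A * Mor B) s t
       (fun x => (ident A (fst x), ident B (snd x)))
       (fun q p h => (comp A (eta (fst q, snd p)) (fst p) (compA q p h),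
                      comp B (snd q) (snd p) (compB q p h)))
       _ _ _ _ _ _ _).
  - intros [a b]; unfold s; cbn; now rewrite !src_ident.
  - intros [a b]; unfold t; cbn; now rewrite !tgt_ident.
  - intros q p h; unfold s; cbn; now rewrite !src_comp.
  - intros q p h; unfold t; cbn; now rewrite !tgt_comp, eta_tgt.
  - intros [k f] h; cbn; f_equal; apply comp_unit_l; [apply eta_id_l | easy].
  - intros [k f] h; cbn; f_equal.
    + transitivity (eta (k, ident B (src B f))); [| apply eta_id_r].
      apply comp_unit_r; now rewrite eta_src.
    + now apply comp_unit_r.
  - intros [k3 f3] [k2 f2] [k1 f1] h32 h21 hl hr; cbn; f_equal.
    + destruct (eta_comp_l f1 _ _ (compA _ _ h32)) as [h' e]; cbn in h', e.
      assert (hl' : src A (comp A _ _ h') = tgt A k1)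
        by (rewrite src_comp, eta_src; exact (f_equal fst h21)).
      assert (hr' : src A (eta (eta (k3, f2), f1))
                    = tgt A (comp A _ _ (compA _ _ h21)))
        by (rewrite tgt_comp; exact h').
      transitivity (comp A _ k1 hl'); [now apply comp_congr |].
      transitivity (comp A _ _ hr'); [apply comp_assoc |].
      apply comp_congr; [symmetry; apply eta_comp_r | easy].
    + apply comp_assoc.
  - split; [easy | split; [easy |]].
    intros k2 k1 f2 f1 h.
    exists (compA _ _ h), (compB _ _ h); reflexivity.
Qed.
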